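(* Let $\mathcal M:\ \mathbf z=\mathbf z(x,y)=(z_1,z_2,z_3)$, $(x,y)\in\mathcal D\subset\mathbb C$, be a minimal strongly regular surface in $\mathbb R^3$ parameterized with canonical principal parameters $(x,y)$. Write $z=x+iy$ for the complex coordinate on $\mathcal D$. Then for every point $\mathbf z_0\in\mathcal D$, there are a simply connected open neighborhood $\mathcal D_0\subset\mathcal D$ of $\mathbf z_0$ and a holomorphic function $w=u(x,y)+iv(x,y)$ on $\mathcal D_0$ such that the function $$\mu:=\frac{u_x^2+u_y^2}{(u^2+v^2+1)^2}$$ satisfies $$\mu>0,\qquad \mu_x\,\mu_y\neq 0\qquad\text{on }\mathcal D_0,$$ and such that, up to a motion (orientation-preserving isometry) of $\mathbb R^3$, the surface $\mathcal M$ is given on $\mathcal D_0$ by $$z_1=\operatorname{Re}\left(\frac12\int_{\mathbf z_0}^{z}\frac{w^2-1}{w'}\,dz\right),\qquad z_2=\operatorname{Re}\left(-\frac i2\int_{\mathbf z_0}^{z}\frac{w^2+1}{w'}\,dz\right),\qquad z_3=\operatorname{Re}\left(-\int_{\mathbf z_0}^{z}\frac{w}{w'}\,dz\right),$$ where $w'=dw/dz$ and the integrals are taken along paths in $\mathcal D_0$ from $\mathbf z_0$ to the point $z=x+iy\in\mathcal D_0$.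
   Context: All functions are $C^\infty$; $\mathcal D$ is an open connected subset of $\mathbb R^2\cong\mathbb C$. For a regular surface $\mathbf z=\mathbf z(x,y)$ in Euclidean space $\mathbb R^3$ with unit normal field $l$, let $E=\mathbf z_x\cdot\mathbf z_x$, $F=\mathbf z_x\cdot\mathbf z_y$, $G=\mathbf z_y\cdot\mathbf z_y$ and $e=\mathbf z_{xx}\cdot l$, $f=\mathbf z_{xy}\cdot l$, $g=\mathbf z_{yy}\cdot l$ be the coefficients of the first and second fundamental forms. The parameters are principal if the surface has no umbilical points and $F=f=0$. For principal parameters put $X=\mathbf z_x/\sqrt E$, $Y=\mathbf z_y/\sqrt G$; it is always assumed that the frame $(X,Y,l)$ is right oriented (i.e. $l=X\times Y$) and that the principal curvatures $\nu_1=e/E$, $\nu_2=g/G$ satisfy $\nu_1-\nu_2>0$. The principal geodesic curvatures are $\gamma_1=-\dfrac{E_y}{2E\sqrt G}$, $\gamma_2=\dfrac{G_x}{2G\sqrt E}$. The surface is strongly regular if $\gamma_1\gamma_2\neq0$ at every point of $\mathcal D$. For a minimal surface ($\nu_1+\nu_2=0$) the function $\nu:=\nu_1=-\nu_2>0$ is called the normal curvature function. Principal parameters $(x,y)$ on a minimal strongly regular surface are canonical if $$E=G=\frac1\nu,\qquad F=0,\qquad e=1,\quad f=0,\quad g=-1.$$ *)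

(* Defs.v *)
From Stdlib Require Export Reals.
From Coquelicot Require Export Coquelicot.
Open Scope R_scope.

Definition R3 : Type := (R * R * R)%type.

Definition c1 (p : R3) : R := fst (fst p).
Definition c2 (p : R3) : R := snd (fst p).
Definition c3 (p : R3) : R := snd p.

Definition sub3 (p q : R3) : R3 := (c1 p - c1 q, c2 p - c2 q, c3 p - c3 q).
Definition scal3 (a : R) (p : R3) : R3 := (a * c1 p, a * c2 p, a * c3 p).
Definition dot (p q : R3) : R := c1 p * c1 q + c2 p * c2 q + c3 p * c3 q.
Definition cross (p q : R3) : R3 :=
  (c2 p * c3 q - c3 p * c2 q,
   c3 p * c1 q - c1 p * c3 q,
   c1 p * c2 q - c2 p * c1 q).
Definition det3 (p q r : R3) : R := dot p (cross q r).
Definition dist3 (p q : R3) : R := sqrt (dot (sub3 p q) (sub3 p q)).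

Definition motion (T : R3 -> R3) : Prop :=
  (forall p q, dist3 (T p) (T q) = dist3 p q) /\
  (forall o p q r,
     0 < det3 (sub3 p o) (sub3 q o) (sub3 r o) ->
     0 < det3 (sub3 (T p) (T o)) (sub3 (T q) (T o)) (sub3 (T r) (T o))).

Definition dx (f : R -> R -> R) (x y : R) : R := Derive (fun s => f s y) x.
Definition dy (f : R -> R -> R) (x y : R) : R := Derive (fun s => f x s) y.

Definition vdx (M : R -> R -> R3) (x y : R) : R3 :=
  (dx (fun s t => c1 (M s t)) x y,
   dx (fun s t => c2 (M s t)) x y,
   dx (fun s t => c3 (M s t)) x y).
Definition vdy (M : R -> R -> R3) (x y : R) : R3 :=
  (dy (fun s t => c1 (M s t)) x y,
   dy (fun s t => c2 (M s t)) x y,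
   dy (fun s t => c3 (M s t)) x y).

(* [ex_diff_n f n x y] asks that all iterated partial derivatives of order
   <= n, in every order of differentiation, exist and be continuous at (x,y);
   required at all points of an open set, for all n, this is C^oo. *)
Definition smooth_on (D : C -> Prop) (f : R -> R -> R) : Prop :=
  forall x y, D (x, y) -> forall n, ex_diff_n f n x y.
Definition smooth3_on (D : C -> Prop) (M : R -> R -> R3) : Prop :=
  smooth_on D (fun x y => c1 (M x y)) /\
  smooth_on D (fun x y => c2 (M x y)) /\
  smooth_on D (fun x y => c3 (M x y)).

Definition coefE (M : R -> R -> R3) (x y : R) : R :=
  dot (vdx M x y) (vdx M x y).
Definition coefF (M : R -> R -> R3) (x y : R) : R :=
  dot (vdx M x y) (vdy M x y).
Definition coefG (M : R -> R -> R3) (x y : R) : R :=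
  dot (vdy M x y) (vdy M x y).
Definition coefe (M l : R -> R -> R3) (x y : R) : R :=
  dot (vdx (vdx M) x y) (l x y).
Definition coeff (M l : R -> R -> R3) (x y : R) : R :=
  dot (vdy (vdx M) x y) (l x y).
Definition coefg (M l : R -> R -> R3) (x y : R) : R :=
  dot (vdy (vdy M) x y) (l x y).

Definition regular_surface (D : C -> Prop) (M l : R -> R -> R3) : Prop :=
  smooth3_on D M /\ smooth3_on D l /\
  forall x y, D (x, y) ->
    cross (vdx M x y) (vdy M x y) <> (0, 0, 0) /\
    dot (l x y) (l x y) = 1 /\
    dot (vdx M x y) (l x y) = 0 /\
    dot (vdy M x y) (l x y) = 0.

(* The second fundamental form is a multiple of the first one. *)
Definition umbilical (M l : R -> R -> R3) (x y : R) : Prop :=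
  exists k, coefe M l x y = k * coefE M x y /\
            coeff M l x y = k * coefF M x y /\
            coefg M l x y = k * coefG M x y.

Definition frameX (M : R -> R -> R3) (x y : R) : R3 :=
  scal3 (/ sqrt (coefE M x y)) (vdx M x y).
Definition frameY (M : R -> R -> R3) (x y : R) : R3 :=
  scal3 (/ sqrt (coefG M x y)) (vdy M x y).

Definition nu1 (M l : R -> R -> R3) (x y : R) : R :=
  coefe M l x y / coefE M x y.
Definition nu2 (M l : R -> R -> R3) (x y : R) : R :=
  coefg M l x y / coefG M x y.

(* Includes the standing normalization: (X, Y, l) is right oriented
   and nu1 - nu2 > 0. *)
Definition principal_parameters (D : C -> Prop) (M l : R -> R -> R3) : Prop :=
  forall x y, D (x, y) ->
    ~ umbilical M l x y /\
    coefF M x y = 0 /\ coeff M l x y = 0 /\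
    l x y = cross (frameX M x y) (frameY M x y) /\
    nu1 M l x y - nu2 M l x y > 0.

Definition gamma1 (M : R -> R -> R3) (x y : R) : R :=
  - (dy (coefE M) x y / (2 * coefE M x y * sqrt (coefG M x y))).
Definition gamma2 (M : R -> R -> R3) (x y : R) : R :=
  dx (coefG M) x y / (2 * coefG M x y * sqrt (coefE M x y)).

Definition strongly_regular (D : C -> Prop) (M : R -> R -> R3) : Prop :=
  forall x y, D (x, y) -> gamma1 M x y * gamma2 M x y <> 0.

Definition minimal (D : C -> Prop) (M l : R -> R -> R3) : Prop :=
  forall x y, D (x, y) -> nu1 M l x y + nu2 M l x y = 0.

(* On a minimal surface the normal curvature function nu is nu1. *)
Definition canonical_parameters (D : C -> Prop) (M l : R -> R -> R3) : Prop :=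
  forall x y, D (x, y) ->
    coefE M x y = 1 / nu1 M l x y /\ coefG M x y = 1 / nu1 M l x y /\
    coefF M x y = 0 /\
    coefe M l x y = 1 /\ coeff M l x y = 0 /\ coefg M l x y = -1.

(* Coquelicot's [is_connected] only concerns subsets of R. *)
Definition connected_set (A : C -> Prop) : Prop :=
  forall U V : C -> Prop, open U -> open V ->
    (forall p, A p -> U p \/ V p) ->
    (exists p, A p /\ U p) -> (exists p, A p /\ V p) ->
    exists p, A p /\ U p /\ V p.

Definition unit_itv (t : R) : Prop := 0 <= t <= 1.

Definition simply_connected (A : C -> Prop) : Prop :=
  (forall p q, A p -> A q ->
     exists c : R -> C,
       continuous_on unit_itv c /\ (forall t, unit_itv t -> A (c t)) /\
       c 0 = p /\ c 1 = q) /\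
  (forall c : R -> C,
     continuous_on unit_itv c -> (forall t, unit_itv t -> A (c t)) ->
     c 0 = c 1 ->
     exists H : R * R -> C,
       continuous_on (fun st => unit_itv (fst st) /\ unit_itv (snd st)) H /\
       (forall s t, unit_itv s -> unit_itv t -> A (H (s, t))) /\
       (forall t, unit_itv t -> H (0, t) = c t /\ H (1, t) = c 0) /\
       (forall s, unit_itv s -> H (s, 0) = c 0 /\ H (s, 1) = c 0)).

(* Complex differentiability: the scalar field of [ex_derive] is C here. *)
Definition holomorphic_on (A : C -> Prop) (w : C -> C) : Prop :=
  forall z, A z -> @ex_derive C_AbsRing C_NormedModule w z.

Definition C1_curve (g : R -> C) : Prop :=
  forall t, ex_derive (fun s => Re (g s)) t /\
            continuous (Derive (fun s => Re (g s))) t /\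
            ex_derive (fun s => Im (g s)) t /\
            continuous (Derive (fun s => Im (g s))) t.

(* Piecewise C^1 on [0,1]: on each closed interval of a subdivision
   0 = a 0 < ... < a n = 1 the curve coincides with a C^1 curve on R. *)
Definition piecewise_C1 (c : R -> C) : Prop :=
  exists (n : nat) (a : nat -> R),
    a 0%nat = 0 /\ a n = 1 /\
    forall i, (i < n)%nat ->
      a i < a (S i) /\
      exists g, C1_curve g /\
        forall t, a i <= t <= a (S i) -> c t = g t.

Definition path_in (A : C -> Prop) (p q : C) (c : R -> C) : Prop :=
  piecewise_C1 c /\ (forall t, unit_itv t -> A (c t)) /\ c 0 = p /\ c 1 = q.

Definition curve_deriv (c : R -> C) (t : R) : C :=
  (Derive (fun s => Re (c s)) t, Derive (fun s => Im (c s)) t).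

(* "The integral of f dz along c exists and equals I." The finitely many
   break points of c do not affect the Riemann integral. *)
Definition is_path_integral (f : C -> C) (c : R -> C) (I : C) : Prop :=
  @is_RInt C_R_NormedModule (fun t => Cmult (f (c t)) (curve_deriv c t)) 0 1 I.

Definition mu (w : C -> C) (x y : R) : R :=
  let u := fun x y => Re (w (x, y)) in
  let v := fun x y => Im (w (x, y)) in
  ((dx u x y) ^ 2 + (dy u x y) ^ 2) / ((u x y) ^ 2 + (v x y) ^ 2 + 1) ^ 2.

(* Main.v *)
Require Import Defs.
From Stdlib Require Import Lra Lia.

(** The holomorphic function is the Gauss map read in a stereographic chart. In canonical
    parameters the tangent vectors [a = M_x] and [b = M_y] are orthogonal of equal length
    [sqrt E], and [(a, b, l)] is a positively oriented frame. The conditions [e = 1], [f = 0],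
    [g = - 1] become the Weingarten equations [l_x = - a / E], [l_y = b / E]
    ([canonical_weingarten]). These first-order data are all that the argument needs, and they
    are preserved by a rotation of space; a half-turn about the first axis, if necessary,
    brings the normal at the base point away from the north pole ([turn]).

    Let [w = (l1 + i l2) / (1 - l3)] on a small square around the base point. The Weingarten
    equations and the relations [b = cross l a], [a = cross b l] yield the Cauchy-Riemann
    equations ([gauss_map_differentiable]), and [|w'|^2 = 1 / (E (1 - l3)^2)]
    ([gauss_deriv_norm]). Hence [w'] has no zero, and [mu = 1 / (4 E)] ([gauss_map_mu]): the
    condition on the partial derivatives of [mu] is strong regularity.

    The Weierstrass formulas are then three pointwise identities in the coordinates of an
    orthonormal frame: [(w^2 - 1) / w'], [(w^2 + 1) / w'] and [w / w'] are, up to the constants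
    [2], [2 i] and [- 1], the coordinates of [M_x - i M_y] ([gauss_weierstrass_1] and its two
    companions). As [dM = Re ((M_x - i M_y) dz)], the coordinates of [M] are potentials of the
    real parts of the integrands, and the fundamental theorem of calculus along the pieces of
    a path gives the increments of [M] ([path_integral_potential]). The translation that moves
    the base point to the origin completes the motion. *)

(** * Differentiability of functions of two real variables *)

(** The mean value theorem in [x], uniformly in [y], absorbs the error in the first
    variable; this is why the partial derivative in [x] must be continuous as a function of
    both variables, whereas for [y] existence at the point suffices. *)
Lemma C1_differentiable (f : R -> R -> R) (x y : R) :
  locally_2d (fun s t => ex_derive (fun z => f z t) s) x y ->
  ex_derive (fun z => f x z) y ->
  continuity_2d_pt (dx f) x y ->
  differentiable_pt_lim f x y (dx f x y) (dy f x y).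
Proof.
  intros Hx Hy Hc.
  apply filterdiff_differentiable_pt_lim.
  apply filterdiff_ext_lin with
    (fun u : R * R => plus (scal (fst u) (dx f x y)) (scal (snd u) (dy f x y))).
  - apply is_derive_filterdiff with (dfx := dx f).
    + apply (locally_2d_locally (fun s t => is_derive (fun z => f z t) s (dx f s t))).
      destruct Hx as [d Hd]; exists d; intros s t Hs Ht.
      now apply Derive_correct, Hd.
    + now apply Derive_correct.
    + now apply continuity_2d_pt_filterlim.
  - intros u; reflexivity.
Qed.

Lemma differentiable_ex_derive (f : R -> R -> R) (x y p q : R) :
  differentiable_pt_lim f x y p q ->
  ex_derive (fun s => f s y) x /\ ex_derive (fun t => f x t) y.
Proof.
  intros H. split.
  - exists (p * 1 + q * 0). apply is_derive_Reals.
    apply (derivable_pt_lim_comp_2d f (fun s => s) (fun _ => y) x p q 1 0 H);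
      [apply derivable_pt_lim_id|apply derivable_pt_lim_const].
  - exists (p * 0 + q * 1). apply is_derive_Reals.
    apply (derivable_pt_lim_comp_2d f (fun _ => x) (fun t => t) y p q 0 1 H);
      [apply derivable_pt_lim_const|apply derivable_pt_lim_id].
Qed.

Lemma differentiable_locally_constant (f : R -> R -> R) (x y p q k : R) :
  locally_2d (fun s t => f s t = k) x y -> differentiable_pt_lim f x y p q -> p = 0 /\ q = 0.
Proof.
  intros Hk Hf. apply (differentiable_pt_lim_ext f (fun _ _ => k)) in Hf; [|exact Hk].
  apply differentiable_pt_lim_unique in Hf. rewrite !Derive_const in Hf. intuition.
Qed.

Lemma differentiable_scal (s : R) (f : R -> R -> R) (x y p q : R) :
  differentiable_pt_lim f x y p q ->
  differentiable_pt_lim (fun u v => s * f u v) x y (s * p) (s * q).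
Proof.
  intros H.
  assert (Hs : differentiable_pt_lim (fun u _ => s * u) (f x y) (f x y) s 0).
  { apply (differentiable_pt_lim_proj1_0 (fun u => s * u)), is_derive_Reals.
    auto_derive; [trivial|ring]. }
  pose proof (differentiable_pt_lim_comp _ _ _ _ _ _ _ _ _ _ _ Hs H H) as Hc.
  replace (s * p) with (s * p + 0 * p) by ring. replace (s * q) with (s * q + 0 * q) by ring.
  exact Hc.
Qed.

Lemma differentiable_plus (f g : R -> R -> R) (x y fx fy gx gy : R) :
  differentiable_pt_lim f x y fx fy -> differentiable_pt_lim g x y gx gy ->
  differentiable_pt_lim (fun u v => f u v + g u v) x y (fx + gx) (fy + gy).
Proof.
  intros Hf Hg.
  assert (Hp : differentiable_pt_lim Rplus (f x y) (g x y) 1 1).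
  { intros e. exists (mkposreal 1 Rlt_0_1); intros u v _ _.
    match goal with |- Rabs ?d <= _ => replace d with 0 by ring end.
    rewrite Rabs_R0. apply Rmult_le_pos; [left; apply cond_pos|].
    eapply Rle_trans; [apply Rabs_pos|apply Rmax_l]. }
  pose proof (differentiable_pt_lim_comp _ _ _ _ _ _ _ _ _ _ _ Hp Hf Hg) as H.
  now rewrite !Rmult_1_l in H.
Qed.

Lemma differentiable_mult (f g : R -> R -> R) (x y fx fy gx gy : R) :
  differentiable_pt_lim f x y fx fy -> differentiable_pt_lim g x y gx gy ->
  differentiable_pt_lim (fun u v => f u v * g u v) x y
    (fx * g x y + f x y * gx) (fy * g x y + f x y * gy).
Proof.
  intros Hf Hg.
  assert (Hm : differentiable_pt_lim Rmult (f x y) (g x y) (g x y) (f x y)).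
  { assert (Hx : forall s t, is_derive (fun z => z * t) s t) by (intros; auto_derive; [trivial|ring]).
    assert (Hy : is_derive (fun z => f x y * z) (g x y) (f x y)) by (auto_derive; [trivial|ring]).
    generalize (C1_differentiable Rmult (f x y) (g x y)).
    replace (dx Rmult (f x y) (g x y)) with (g x y) by (symmetry; apply is_derive_unique, Hx).
    replace (dy Rmult (f x y) (g x y)) with (f x y) by (symmetry; apply is_derive_unique, Hy).
    intros HC. apply HC.
    - exists (mkposreal 1 Rlt_0_1); intros s t _ _. now exists t.
    - now exists (f x y).
    - apply continuity_2d_pt_ext with (fun _ t : R => t); [|apply continuity_2d_pt_id2].
      intros s t. symmetry. apply is_derive_unique, Hx. }
  pose proof (differentiable_pt_lim_comp _ _ _ _ _ _ _ _ _ _ _ Hm Hf Hg) as H.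
  replace (fx * g x y + f x y * gx) with (g x y * fx + f x y * gx) by ring.
  replace (fy * g x y + f x y * gy) with (g x y * fy + f x y * gy) by ring.
  exact H.
Qed.

Lemma open_locally_2d (D : C -> Prop) (x y : R) :
  open D -> D (x, y) -> locally_2d (fun s t => D (s, t)) x y.
Proof.
  intros HD Hz. apply locally_2d_locally. generalize (HD _ Hz).
  apply filter_imp. now intros [].
Qed.

Lemma smooth_dx (D : C -> Prop) (f : R -> R -> R) : smooth_on D f -> smooth_on D (dx f).
Proof. intros H x y Hz n. exact (ex_diff_n_deriv_aux1 f n x y (H x y Hz (S n))). Qed.

Lemma smooth_dy (D : C -> Prop) (f : R -> R -> R) : smooth_on D f -> smooth_on D (dy f).
Proof. intros H x y Hz n. exact (ex_diff_n_deriv_aux2 f n x y (H x y Hz (S n))). Qed.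

Lemma smooth_continuity (D : C -> Prop) (f : R -> R -> R) (x y : R) :
  smooth_on D f -> D (x, y) -> continuity_2d_pt f x y.
Proof. intros H Hz. apply (H x y Hz 0%nat). Qed.

Lemma smooth_differentiable (D : C -> Prop) (f : R -> R -> R) (x y : R) :
  open D -> smooth_on D f -> D (x, y) ->
  differentiable_pt_lim f x y (dx f x y) (dy f x y).
Proof.
  intros HD Hf Hz. apply C1_differentiable.
  - generalize (open_locally_2d D x y HD Hz). apply locally_2d_impl, locally_2d_forall.
    intros s t Hst. apply (Hf s t Hst 1%nat).
  - apply (Hf x y Hz 1%nat).
  - now apply (smooth_continuity D), Hz; apply smooth_dx.
Qed.

Lemma smooth_schwarz (D : C -> Prop) (f : R -> R -> R) (x y : R) :
  open D -> smooth_on D f -> D (x, y) -> dx (dy f) x y = dy (dx f) x y.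
Proof.
  intros HD Hf Hz. apply Schwarz.
  - generalize (open_locally_2d D x y HD Hz). apply locally_2d_impl, locally_2d_forall.
    intros s t Hst. repeat split.
    + apply (Hf s t Hst 1%nat).
    + apply (Hf s t Hst 1%nat).
    + apply (smooth_dy D f Hf s t Hst 1%nat).
    + apply (smooth_dx D f Hf s t Hst 1%nat).
  - apply (smooth_continuity D (dx (dy f))); [|exact Hz]. now apply smooth_dx, smooth_dy.
  - apply (smooth_continuity D (dy (dx f))); [|exact Hz]. now apply smooth_dy, smooth_dx.
Qed.

(** * Vector-valued functions *)

Definition differentiable3 (m : R -> R -> R3) (x y : R) (a b : R3) : Prop :=
  differentiable_pt_lim (fun s t => c1 (m s t)) x y (c1 a) (c1 b) /\
  differentiable_pt_lim (fun s t => c2 (m s t)) x y (c2 a) (c2 b) /\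
  differentiable_pt_lim (fun s t => c3 (m s t)) x y (c3 a) (c3 b).

Definition continuous3 (m : R -> R -> R3) (x y : R) : Prop :=
  continuity_2d_pt (fun s t => c1 (m s t)) x y /\
  continuity_2d_pt (fun s t => c2 (m s t)) x y /\
  continuity_2d_pt (fun s t => c3 (m s t)) x y.

Lemma differentiable_dot (U V : R -> R -> R3) (x y : R) (a b a' b' : R3) :
  differentiable3 U x y a b -> differentiable3 V x y a' b' ->
  differentiable_pt_lim (fun s t => dot (U s t) (V s t)) x y
    (dot a (V x y) + dot (U x y) a') (dot b (V x y) + dot (U x y) b').
Proof.
  intros (U1 & U2 & U3) (V1 & V2 & V3).
  pose proof (differentiable_plus _ _ _ _ _ _ _ _ (differentiable_plus _ _ _ _ _ _ _ _
    (differentiable_mult _ _ _ _ _ _ _ _ U1 V1) (differentiable_mult _ _ _ _ _ _ _ _ U2 V2))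
    (differentiable_mult _ _ _ _ _ _ _ _ U3 V3)) as H.
  match type of H with differentiable_pt_lim _ _ _ ?p ?q =>
    replace (dot a (V x y) + dot (U x y) a') with p by (unfold dot; ring);
    replace (dot b (V x y) + dot (U x y) b') with q by (unfold dot; ring) end.
  exact H.
Qed.

Lemma smooth3_vdx (D : C -> Prop) (M : R -> R -> R3) : smooth3_on D M -> smooth3_on D (vdx M).
Proof. intros (H1 & H2 & H3). split; [|split]; now apply smooth_dx. Qed.

Lemma smooth3_vdy (D : C -> Prop) (M : R -> R -> R3) : smooth3_on D M -> smooth3_on D (vdy M).
Proof. intros (H1 & H2 & H3). split; [|split]; now apply smooth_dy. Qed.

Lemma smooth3_continuous3 (D : C -> Prop) (M : R -> R -> R3) (x y : R) :
  smooth3_on D M -> D (x, y) -> continuous3 M x y.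
Proof. intros (H1 & H2 & H3) Hz. split; [|split]; now apply (smooth_continuity D). Qed.

Lemma smooth3_differentiable3 (D : C -> Prop) (M : R -> R -> R3) (x y : R) :
  open D -> smooth3_on D M -> D (x, y) -> differentiable3 M x y (vdx M x y) (vdy M x y).
Proof.
  intros HD (H1 & H2 & H3) Hz. split; [|split]; now apply (smooth_differentiable D).
Qed.

(** * Complex derivatives and path integrals *)

Lemma filterlim_pair_C {T : Type} (F : (T -> Prop) -> Prop) {FF : Filter F}
  (f g : T -> R) (a b : R) :
  filterlim f F (locally a) -> filterlim g F (locally b) ->
  filterlim (fun t => (f t, g t) : C) F (locally (a, b)).
Proof.
  intros Hf Hg P [e He].
  generalize (filter_and (F := F) (fun t => ball a e (f t)) (fun t => ball b e (g t))
    (Hf _ (locally_ball a e)) (Hg _ (locally_ball b e))).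
  unfold filtermap. apply filter_imp. intros t [H1 H2]. apply He. now split.
Qed.

(** The Cauchy-Riemann equations say that the real differential of [(u, v)] is
    multiplication by [p + i q]. The only analytic point is the passage from the maximum norm
    of the plane to the modulus, which costs a factor [sqrt 2]. *)
Lemma cauchy_riemann_is_derive (u v : R -> R -> R) (x y p q : R) :
  differentiable_pt_lim u x y p (- q) ->
  differentiable_pt_lim v x y q p ->
  @is_derive C_AbsRing C_NormedModule
    (fun z => (u (fst z) (snd z), v (fst z) (snd z)) : C) (x, y) (p, q).
Proof.
  intros Hu Hv. split.
  { apply (is_linear_scal_l (K := C_AbsRing) (V := C_NormedModule)). }
  intros z Hz.
  rewrite <- (is_filter_lim_locally_unique (K := C_AbsRing)
    (V := AbsRing_NormedModule C_AbsRing) (x, y) z Hz).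
  intros eps.
  apply (locally_C (x, y)).
  assert (He : 0 < eps / sqrt 2).
  { apply Rdiv_lt_0_compat; [apply cond_pos | apply sqrt_lt_R0; lra]. }
  destruct (Hu (mkposreal _ He)) as [d1 H1].
  destruct (Hv (mkposreal _ He)) as [d2 H2].
  exists (mkposreal _ (Rmin_stable_in_posreal d1 d2)).
  intros [s t] [Hs Ht]; simpl in Hs, Ht.
  change (Rabs (s - x) < Rmin d1 d2) in Hs; change (Rabs (t - y) < Rmin d1 d2) in Ht.
  specialize (H1 s t (Rlt_le_trans _ _ _ Hs (Rmin_l _ _)) (Rlt_le_trans _ _ _ Ht (Rmin_l _ _))).
  specialize (H2 s t (Rlt_le_trans _ _ _ Hs (Rmin_r _ _)) (Rlt_le_trans _ _ _ Ht (Rmin_r _ _))).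
  simpl in H1, H2.
  set (m := Rmax (Rabs (s - x)) (Rabs (t - y))) in *.
  match goal with |- @norm C_AbsRing C_NormedModule ?a <= _ * @norm _ _ ?b =>
    change (Cmod a <= eps * Cmod b); set (err := a); set (inc := b) end.
  assert (Hm : m <= Cmod inc) by exact (Rmax_Cmod inc).
  assert (Herr : Rmax (Rabs (fst err)) (Rabs (snd err)) <= eps / sqrt 2 * m).
  { apply Rmax_lub.
    - eapply Rle_trans; [right | exact H1]. f_equal. unfold err; cbn. ring.
    - eapply Rle_trans; [right | exact H2]. f_equal. unfold err; cbn. ring. }
  eapply Rle_trans; [apply Cmod_2Rmax|].
  assert (H2p : 0 < sqrt 2) by (apply sqrt_lt_R0; lra).
  apply Rle_trans with (sqrt 2 * (eps / sqrt 2 * m)).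
  - now apply Rmult_le_compat_l; [left|].
  - replace (sqrt 2 * (eps / sqrt 2 * m)) with (eps * m) by (field; lra).
    apply Rmult_le_compat_l; [left; apply cond_pos | exact Hm].
Qed.

(** If [dP = Re (k f dz)] then [P (g t)] is a primitive of [Re (k f (g t) g' (t))]. The
    integral is chosen before [k] and [P] because the value of the complex integral has to be
    fixed independently of the real form that is integrated. *)
Lemma C1_curve_integral (A : C -> Prop) (f : C -> C) (g : R -> C) (a b : R) :
  (forall z, A z -> continuous f z) ->
  C1_curve g -> a < b -> (forall t, a <= t <= b -> A (g t)) ->
  exists I : C,
    @is_RInt C_R_NormedModule (fun t => Cmult (f (g t)) (curve_deriv g t)) a b I /\
    forall (k : C) (P : R -> R -> R),
      (forall x y, A (x, y) ->
         differentiable_pt_lim P x y (Re (k * f (x, y))%C) (- Im (k * f (x, y))%C)) ->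
      Re (k * I)%C = P (fst (g b)) (snd (g b)) - P (fst (g a)) (snd (g a)).
Proof.
  intros Hf Hg Hab HA.
  set (g1' := Derive (fun s => Re (g s))). set (g2' := Derive (fun s => Im (g s))).
  assert (Hcg : forall t, continuous g t).
  { intros t. destruct (Hg t) as (D1 & _ & D2 & _).
    apply ex_derive_continuous in D1. apply ex_derive_continuous in D2.
    apply continuous_ext with (fun s => (Re (g s), Im (g s))).
    - intros s; now destruct (g s).
    - apply (continuous_comp_2 (fun s => Re (g s)) (fun s => Im (g s)) (fun u v : R => (u, v)) t D1 D2).
      apply continuous_ext with (fun z : R * R => z); [now intros []|apply continuous_id]. }
  assert (Hcf : forall t, a <= t <= b -> continuous (fun s => f (g s)) t).
  { intros t Ht. apply continuous_comp; [apply Hcg|apply Hf, HA, Ht]. }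
  assert (Hcf1 : forall t, a <= t <= b -> continuous (fun s => fst (f (g s))) t).
  { intros t Ht. apply (continuous_comp (fun s => f (g s)) fst); [now apply Hcf|apply continuous_fst]. }
  assert (Hcf2 : forall t, a <= t <= b -> continuous (fun s => snd (f (g s))) t).
  { intros t Ht. apply (continuous_comp (fun s => f (g s)) snd); [now apply Hcf|apply continuous_snd]. }
  assert (HcR : forall t, a <= t <= b ->
    continuous (fun s => fst (f (g s)) * g1' s - snd (f (g s)) * g2' s) t).
  { intros t Ht. destruct (Hg t) as (_ & D1 & _ & D2).
    apply (continuous_minus (V := R_NormedModule)); apply (continuous_mult (K := R_AbsRing)); auto. }
  assert (HcI : forall t, a <= t <= b ->
    continuous (fun s => fst (f (g s)) * g2' s + snd (f (g s)) * g1' s) t).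
  { intros t Ht. destruct (Hg t) as (_ & D1 & _ & D2).
    apply (continuous_plus (V := R_NormedModule)); apply (continuous_mult (K := R_AbsRing)); auto. }
  assert (Hmm : Rmin a b = a /\ Rmax a b = b).
  { now split; [apply Rmin_left|apply Rmax_right]; left. }
  destruct Hmm as [Hmin Hmax].
  destruct (ex_RInt_continuous (V := R_CompleteNormedModule) _ a b
    (fun t Ht => HcR t ltac:(now rewrite Hmin, Hmax in Ht))) as [I1 HI1].
  destruct (ex_RInt_continuous (V := R_CompleteNormedModule) _ a b
    (fun t Ht => HcI t ltac:(now rewrite Hmin, Hmax in Ht))) as [I2 HI2].
  exists (I1, I2); split.
  { apply (is_RInt_fct_extend_pair (U := R_NormedModule) (V := R_NormedModule)); [exact HI1|exact HI2]. }
  intros k P HP.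
  set (dP := fun t => fst k * (fst (f (g t)) * g1' t - snd (f (g t)) * g2' t)
                      - snd k * (fst (f (g t)) * g2' t + snd (f (g t)) * g1' t)).
  assert (HdP1 : is_RInt dP a b (fst k * I1 - snd k * I2)).
  { apply (is_RInt_minus (V := R_NormedModule)); now apply (is_RInt_scal (V := R_NormedModule)). }
  assert (HdP2 : is_RInt dP a b (minus (P (fst (g b)) (snd (g b))) (P (fst (g a)) (snd (g a))))).
  { apply (is_RInt_derive (V := R_CompleteNormedModule) (fun t => P (fst (g t)) (snd (g t))));
      rewrite Hmin, Hmax; intros t Ht.
    - destruct (Hg t) as (D1 & _ & D2 & _).
      apply is_derive_Reals.
      specialize (HA t Ht). rewrite (surjective_pairing (g t)) in HA. specialize (HP _ _ HA).
      rewrite <- surjective_pairing in HP.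
      apply Derive_correct, is_derive_Reals in D1.
      apply Derive_correct, is_derive_Reals in D2.
      pose proof (derivable_pt_lim_comp_2d P (fun s => Re (g s)) (fun s => Im (g s))
        t _ _ _ _ HP D1 D2) as HD.
      match type of HD with derivable_pt_lim _ _ ?L => replace (dP t) with L; [exact HD|] end.
      unfold dP, g1', g2'; simpl; ring.
    - apply (continuous_minus (V := R_NormedModule)); apply (continuous_scal_r (V := R_NormedModule)); auto. }
  apply (is_RInt_unique (V := R_CompleteNormedModule)) in HdP1.
  apply (is_RInt_unique (V := R_CompleteNormedModule)) in HdP2.
  rewrite HdP1 in HdP2. exact HdP2.
Qed.

(** On the pieces of a subdivision the path is a [C1] curve, and the increments of the
    potential telescope. *)
Lemma path_integral_potential (A : C -> Prop) (f : C -> C) (p q : C) (c : R -> C) :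
  (forall z, A z -> continuous f z) -> path_in A p q c ->
  exists I : C, is_path_integral f c I /\
    forall (k : C) (P : R -> R -> R),
      (forall x y, A (x, y) ->
         differentiable_pt_lim P x y (Re (k * f (x, y))%C) (- Im (k * f (x, y))%C)) ->
      Re (k * I)%C = P (fst q) (snd q) - P (fst p) (snd p).
Proof.
  intros Hf ((n & a & Ha0 & Han & Hpc) & HA & <- & <-).
  assert (Hlo : forall i, (i <= n)%nat -> 0 <= a i).
  { induction i as [|i IH]; intros Hi; [lra|].
    destruct (Hpc i) as [Hlt _]; [lia|]. specialize (IH ltac:(lia)). lra. }
  (* the upper bound propagates from the right end of the subdivision, hence downwards *)
  assert (Hhi : forall j, (j <= n)%nat -> a (n - j)%nat <= 1).
  { induction j as [|j IH]; intros Hj; [rewrite Nat.sub_0_r; lra|].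
    destruct (Hpc (n - S j)%nat) as [Hlt _]; [lia|]. specialize (IH ltac:(lia)).
    replace (S (n - S j)) with (n - j)%nat in Hlt by lia. lra. }
  assert (Hsum : forall i, (i <= n)%nat -> exists I : C,
    @is_RInt C_R_NormedModule (fun t => Cmult (f (c t)) (curve_deriv c t)) 0 (a i) I /\
    forall (k : C) (P : R -> R -> R),
      (forall x y, A (x, y) ->
         differentiable_pt_lim P x y (Re (k * f (x, y))%C) (- Im (k * f (x, y))%C)) ->
      Re (k * I)%C = P (fst (c (a i))) (snd (c (a i))) - P (fst (c 0)) (snd (c 0))).
  { induction i as [|i IH]; intros Hi.
    - exists (0, 0). rewrite Ha0. split; [apply (is_RInt_point (V := C_R_NormedModule))|].
      intros k P _. simpl. ring.
    - destruct IH as (I & HI & HIP); [lia|].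
      destruct (Hpc i) as (Hlt & g & Hg & Hcg); [lia|].
      pose proof (Hlo i ltac:(lia)) as Hl.
      pose proof (Hhi (n - S i)%nat ltac:(lia)) as Hh.
      replace (n - (n - S i))%nat with (S i) in Hh by lia.
      destruct (C1_curve_integral A f g (a i) (a (S i)) Hf Hg Hlt) as (J & HJ & HJP).
      { intros t Ht. rewrite <- Hcg by exact Ht. apply HA. unfold unit_itv; lra. }
      exists (Cplus I J); split.
      + apply (is_RInt_Chasles (V := C_R_NormedModule)) with (a i); [exact HI|].
        apply (is_RInt_ext (V := C_R_NormedModule)) with (2 := HJ).
        rewrite Rmin_left, Rmax_right by lra. intros t Ht.
        (* [c] may fail to be differentiable at the ends of the piece, but inside it agrees
           with [g] near [t], and so does its derivative *)
        assert (Hloc : locally t (fun s => g s = c s)).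
        { apply (locally_interval _ t (a i) (a (S i))); simpl; try lra.
          intros s Hs1 Hs2. symmetry. apply Hcg. simpl in *; lra. }
        rewrite Hcg by lra. f_equal.
        unfold curve_deriv. f_equal; apply Derive_ext_loc; revert Hloc; apply filter_imp;
          now intros s ->.
      + intros k P HP. specialize (HIP k P HP). specialize (HJP k P HP).
        rewrite <- !Hcg in HJP by lra.
        replace (Re (k * (I + J))%C) with (Re (k * I)%C + Re (k * J)%C) by (simpl; ring).
        rewrite HIP, HJP. ring. }
  destruct (Hsum n (le_n n)) as (I & HI & HIP). rewrite Han in *. now exists I.
Qed.

(** The constant [kappa] is the one by which the integrand [f] differs from a coordinate of
    [M_x - i M_y], and [k] the constant in front of the integral that compensates it. *)
Lemma isotropic_path_integral (A : C -> Prop) (f : C -> C) (m a b : R -> R -> R) (kappa k : C)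
  (p q : C) (c : R -> C) :
  open A -> (k * kappa = 1)%C ->
  (forall x y, A (x, y) -> f (x, y) = (kappa * ((a x y, - b x y)%R : C))%C /\
     differentiable_pt_lim m x y (a x y) (b x y) /\
     continuity_2d_pt a x y /\ continuity_2d_pt b x y) ->
  path_in A p q c ->
  exists I, is_path_integral f c I /\
    Re (k * I)%C = m (fst q) (snd q) - m (fst p) (snd p).
Proof.
  intros HA Hk H Hc.
  destruct (path_integral_potential A f p q c) as (I & HI & HP); [|exact Hc|].
  - intros [x y] Hz.
    apply continuous_ext_loc with (fun z : C => (kappa * ((a (fst z) (snd z), - b (fst z) (snd z))%R : C))%C).
    + generalize (HA _ Hz). apply filter_imp. intros [s t] Hst. symmetry. now apply H.
    + destruct (H x y Hz) as (_ & _ & Ha & Hb).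
      assert (Ha' := proj1 (continuity_2d_pt_filterlim _ _ _) Ha).
      assert (Hb' := proj1 (continuity_2d_pt_filterlim _ _ _) Hb).
      apply (filterlim_pair_C (locally ((x, y) : C))
        (fun z => fst kappa * a (fst z) (snd z) - snd kappa * - b (fst z) (snd z))
        (fun z => fst kappa * - b (fst z) (snd z) + snd kappa * a (fst z) (snd z))).
      * apply (continuous_minus (V := R_NormedModule)
          (fun z => fst kappa * a (fst z) (snd z)) (fun z => snd kappa * - b (fst z) (snd z)) (x, y));
        apply (continuous_scal_r (V := R_NormedModule)); [exact Ha'|].
        now apply (continuous_opp (V := R_NormedModule)).
      * apply (continuous_plus (V := R_NormedModule)
          (fun z => fst kappa * - b (fst z) (snd z)) (fun z => snd kappa * a (fst z) (snd z)) (x, y));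
        apply (continuous_scal_r (V := R_NormedModule)); [|exact Ha'].
        now apply (continuous_opp (V := R_NormedModule)).
  - exists I; split; [exact HI|]. apply HP.
    intros x y Hz. destruct (H x y Hz) as (-> & Hm & _).
    rewrite Cmult_assoc, Hk, Cmult_1_l. simpl. now rewrite Ropp_involutive.
Qed.

(** * Convex sets *)

Definition segment (s : R) (p q : C) : C :=
  ((1 - s) * fst p + s * fst q, (1 - s) * snd p + s * snd q).

(** Joint continuity, stated for filters so that it applies to maps that are continuous
    only relative to the unit interval or the unit square. *)
Lemma filterlim_segment {T : Type} (F : (T -> Prop) -> Prop) {FF : Filter F}
  (s : T -> R) (p q : T -> C) (s0 : R) (p0 q0 : C) :
  filterlim s F (locally s0) -> filterlim p F (locally p0) -> filterlim q F (locally q0) ->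
  filterlim (fun t => segment (s t) (p t) (q t)) F (locally (segment s0 p0 q0)).
Proof.
  intros Hs Hp Hq.
  assert (Hcoord : forall (u v : T -> R) (u0 v0 : R),
    filterlim u F (locally u0) -> filterlim v F (locally v0) ->
    filterlim (fun t => (1 - s t) * u t + s t * v t) F (locally ((1 - s0) * u0 + s0 * v0))).
  { intros u v u0 v0 Hu Hv.
    apply (filterlim_comp_2 (G := locally ((1 - s0) * u0)) (H := locally (s0 * v0))
       (fun t => (1 - s t) * u t) (fun t => s t * v t) Rplus);
      [| |apply (filterlim_plus (V := R_NormedModule))].
    - apply (filterlim_comp_2 (G := locally (1 - s0)) (H := locally u0) (fun t => 1 - s t) u Rmult);
        [|exact Hu|apply (filterlim_mult (K := R_AbsRing))].
      apply (filterlim_comp _ _ _ s (fun r => 1 - r) _ (locally s0)); [exact Hs|].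
      apply (continuous_minus (V := R_NormedModule) (fun _ => 1) (fun r => r) s0);
        [apply continuous_const|apply continuous_id].
    - exact (filterlim_comp_2 (G := locally s0) (H := locally v0) s v Rmult Hs Hv
        (filterlim_mult (K := R_AbsRing) s0 v0)). }
  destruct p0 as [p1 p2], q0 as [q1 q2].
  apply (filterlim_pair_C F); apply Hcoord; simpl;
  match goal with |- filterlim (fun t => ?pr (?h t)) _ (locally ?l) =>
    refine (filterlim_comp _ _ _ h pr _ _ _ _ _); [eassumption|];
    first [ apply (continuous_fst (U := R_UniformSpace) (V := R_UniformSpace))
          | apply (continuous_snd (U := R_UniformSpace) (V := R_UniformSpace)) ] end.
Qed.

(** A loop is contracted to its base point along straight segments. *)
Lemma convex_simply_connected (A : C -> Prop) :
  (forall s p q, A p -> A q -> unit_itv s -> A (segment s p q)) ->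
  simply_connected A.
Proof.
  intros Hconv.
  assert (H0 : forall p q, segment 0 p q = p).
  { intros [] []; unfold segment; simpl; f_equal; ring. }
  assert (H1 : forall p q, segment 1 p q = q).
  { intros [] []; unfold segment; simpl; f_equal; ring. }
  assert (Hid : forall s p, segment s p p = p).
  { intros s []; unfold segment; simpl; f_equal; ring. }
  split.
  - intros p q Hp Hq. exists (fun t => segment t p q). repeat split; auto.
    intros t _.
    apply (filterlim_segment (within unit_itv (locally t)) (fun s => s) (fun _ => p) (fun _ => q) t p q);
      [|apply filterlim_const|apply filterlim_const].
    apply (filterlim_filter_le_1 (G := within unit_itv (locally t)) (F := locally t));
      [apply filter_le_within; typeclasses eauto|apply filterlim_id].
  - intros c Hc HA Hloop.
    exists (fun st => segment (fst st) (c (snd st)) (c 0)).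
    split; [|split; [|split]].
    + intros [s t] [Hs Ht]; simpl in Hs, Ht.
      apply (filterlim_segment _ fst (fun st => c (snd st)) (fun _ => c 0) s (c t) (c 0));
        [| |apply filterlim_const].
      * apply (filterlim_filter_le_1 (F := locally (s, t)));
          [apply filter_le_within; typeclasses eauto|].
        apply continuous_fst.
      * apply (filterlim_comp _ _ _ snd c _ (within unit_itv (locally t))); [|now apply Hc].
        intros P [e He]. exists e. intros [s' t'] [_ Ht'] [_ Hu']. now apply He.
    + intros s t Hs Ht. apply Hconv; auto. apply HA. unfold unit_itv; lra.
    + intros t Ht; simpl. now rewrite H0, H1.
    + intros s Hs; simpl. now rewrite <- Hloop, Hid.
Qed.

(** Balls of the product uniform structure on [C] are squares, so convexity is checked on
    each coordinate. *)
Lemma ball_segment (z0 : C) (r : R) (s : R) (p q : C) :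
  @ball C_UniformSpace z0 r p -> @ball C_UniformSpace z0 r q -> unit_itv s ->
  @ball C_UniformSpace z0 r (segment s p q).
Proof.
  assert (Hcoord : forall x u v, Rabs (u - x) < r -> Rabs (v - x) < r -> unit_itv s ->
    Rabs ((1 - s) * u + s * v - x) < r).
  { intros x u v Hu Hv [Hs0 Hs1]. apply Rabs_def2 in Hu, Hv.
    destruct (Req_dec s 0) as [-> | Hs]; [apply Rabs_def1; lra|].
    assert (0 < s) by lra.
    apply Rabs_def1; nra. }
  intros [Hp1 Hp2] [Hq1 Hq2] Hs.
  split; now apply Hcoord.
Qed.

Lemma open_ball_C (z0 : C) (r : R) : open (fun z => @ball C_UniformSpace z0 r z).
Proof.
  intros z [Hx Hy].
  change (Rabs (fst z - fst z0) < r) in Hx. change (Rabs (snd z - snd z0) < r) in Hy.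
  assert (Hd : 0 < Rmin (r - Rabs (fst z - fst z0)) (r - Rabs (snd z - snd z0))).
  { apply Rmin_glb_lt; lra. }
  exists (mkposreal _ Hd). intros z' [Hx' Hy']. simpl in Hx', Hy'.
  change (Rabs (fst z' - fst z) < Rmin (r - Rabs (fst z - fst z0)) (r - Rabs (snd z - snd z0))) in Hx'.
  change (Rabs (snd z' - snd z) < Rmin (r - Rabs (fst z - fst z0)) (r - Rabs (snd z - snd z0))) in Hy'.
  pose proof (Rmin_l (r - Rabs (fst z - fst z0)) (r - Rabs (snd z - snd z0))).
  pose proof (Rmin_r (r - Rabs (fst z - fst z0)) (r - Rabs (snd z - snd z0))).
  pose proof (Rabs_triang (fst z' - fst z) (fst z - fst z0)) as Tx.
  pose proof (Rabs_triang (snd z' - snd z) (snd z - snd z0)) as Ty.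
  replace (fst z' - fst z + (fst z - fst z0)) with (fst z' - fst z0) in Tx by ring.
  replace (snd z' - snd z + (snd z - snd z0)) with (snd z' - snd z0) in Ty by ring.
  split; [change (Rabs (fst z' - fst z0) < r) | change (Rabs (snd z' - snd z0) < r)]; lra.
Qed.

(** * Conformal frames and stereographic projection *)

Lemma dot_comm (p q : R3) : dot p q = dot q p.
Proof. unfold dot; ring. Qed.

Lemma sub3_eq0 (p q : R3) : sub3 p q = (0, 0, 0) -> p = q.
Proof.
  destruct p as [[p1 p2] p3], q as [[q1 q2] q3]; unfold sub3, c1, c2, c3; simpl.
  intros H; injection H; intros. repeat f_equal; lra.
Qed.

(** Cramer's rule: [det3 a b l] times [p] is a combination of [cross b l], [cross l a] and
    [cross a b] whose coefficients are the three scalar products. *)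
Lemma orthogonal_to_frame (p a b l : R3) :
  det3 a b l <> 0 -> dot p a = 0 -> dot p b = 0 -> dot p l = 0 -> p = (0, 0, 0).
Proof.
  destruct p as [[p1 p2] p3], a as [[a1 a2] a3], b as [[b1 b2] b3], l as [[l1 l2] l3].
  unfold det3, dot, cross, c1, c2, c3; cbn [fst snd].
  intros Hd Ha Hb Hl.
  set (d := a1 * (b2 * l3 - b3 * l2) + a2 * (b3 * l1 - b1 * l3) + a3 * (b1 * l2 - b2 * l1)) in *.
  assert (H1 : d * p1 = 0).
  { transitivity ((p1 * a1 + p2 * a2 + p3 * a3) * (b2 * l3 - b3 * l2)
      + (p1 * b1 + p2 * b2 + p3 * b3) * (l2 * a3 - l3 * a2)
      + (p1 * l1 + p2 * l2 + p3 * l3) * (a2 * b3 - a3 * b2)); [unfold d; ring|].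
    rewrite Ha, Hb, Hl; ring. }
  assert (H2 : d * p2 = 0).
  { transitivity ((p1 * a1 + p2 * a2 + p3 * a3) * (b3 * l1 - b1 * l3)
      + (p1 * b1 + p2 * b2 + p3 * b3) * (l3 * a1 - l1 * a3)
      + (p1 * l1 + p2 * l2 + p3 * l3) * (a3 * b1 - a1 * b3)); [unfold d; ring|].
    rewrite Ha, Hb, Hl; ring. }
  assert (H3 : d * p3 = 0).
  { transitivity ((p1 * a1 + p2 * a2 + p3 * a3) * (b1 * l2 - b2 * l1)
      + (p1 * b1 + p2 * b2 + p3 * b3) * (l1 * a2 - l2 * a1)
      + (p1 * l1 + p2 * l2 + p3 * l3) * (a1 * b2 - a2 * b1)); [unfold d; ring|].
    rewrite Ha, Hb, Hl; ring. }
  now f_equal; [f_equal|]; apply (Rmult_eq_reg_l d); rewrite ?Rmult_0_r.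
Qed.

(** In conformal parameters [a], [b] are the tangent vectors of the coordinate lines, [E] is
    the common value of the first fundamental coefficients, and [l] the unit normal. *)
Definition conformal_frame (a b l : R3) (E : R) : Prop :=
  0 < E /\ dot a a = E /\ dot b b = E /\ dot a b = 0 /\
  dot l l = 1 /\ dot a l = 0 /\ dot b l = 0 /\ cross a b = scal3 E l.

Lemma frame_det (a b l : R3) (E : R) : conformal_frame a b l E -> det3 a b l = E.
Proof.
  intros (HE & _ & _ & _ & Hll & _ & _ & Hc).
  transitivity (dot (cross a b) l); [unfold det3, dot, cross, c1, c2, c3; simpl; ring|].
  rewrite Hc. transitivity (E * dot l l); [|rewrite Hll; ring].
  unfold dot, scal3, c1, c2, c3; simpl; ring.
Qed.

Lemma frame_expansion (a b l p : R3) (E : R) :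
  conformal_frame a b l E ->
  E * c1 p = dot p a * c1 a + dot p b * c1 b + E * dot p l * c1 l /\
  E * c2 p = dot p a * c2 a + dot p b * c2 b + E * dot p l * c2 l /\
  E * c3 p = dot p a * c3 a + dot p b * c3 b + E * dot p l * c3 l.
Proof.
  intros HF. pose proof (frame_det _ _ _ _ HF) as Hdet.
  destruct HF as (HE & Haa & Hbb & Hab & Hll & Hal & Hbl & _).
  set (e := (dot p a * c1 a + dot p b * c1 b + E * dot p l * c1 l,
             dot p a * c2 a + dot p b * c2 b + E * dot p l * c2 l,
             dot p a * c3 a + dot p b * c3 b + E * dot p l * c3 l)).
  assert (Hdot : forall v, dot (sub3 (scal3 E p) e) v =
     E * dot p v - (dot p a * dot a v + dot p b * dot b v + E * dot p l * dot l v)).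
  { intros v. unfold e. generalize (dot p a) (dot p b) (dot p l). intros.
    unfold dot, sub3, scal3, c1, c2, c3; simpl; ring. }
  assert (He : scal3 E p = e).
  { apply sub3_eq0, (orthogonal_to_frame _ a b l); [rewrite Hdet; lra| | |]; rewrite Hdot.
    - rewrite Haa, (dot_comm b a), Hab, (dot_comm l a), Hal; ring.
    - rewrite Hbb, Hab, (dot_comm l b), Hbl; ring.
    - rewrite Hal, Hbl, Hll; ring. }
  injection He as E1 E2 E3. auto.
Qed.

Lemma frame_triple_products (a b l : R3) (E : R) :
  conformal_frame a b l E -> cross l a = b /\ cross b l = a.
Proof.
  intros HF. pose proof (frame_det _ _ _ _ HF) as Hdet.
  destruct HF as (HE & Haa & Hbb & Hab & Hll & Hal & Hbl & _).
  assert (Hne : det3 a b l <> 0) by lra.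
  revert Hdet Haa Hbb Hab Hal Hbl.
  split; apply sub3_eq0, (orthogonal_to_frame _ a b l); trivial;
    destruct a as [[a1 a2] a3], b as [[b1 b2] b3], l as [[l1 l2] l3];
    unfold det3, dot, cross, sub3, c1, c2, c3 in *; simpl in *; lra.
Qed.

(** The orthonormality of [(a / sqrt E, b / sqrt E, l)], written for the rows of the matrix
    instead of its columns, together with the length of [l] and the coordinates of [cross a b]
    that are used below. [fc_cr1] and [fc_cr2] are what the Cauchy-Riemann equations of the
    Gauss map reduce to. *)
Record frame_coordinates (a1 a2 a3 b1 b2 b3 l1 l2 l3 E : R) : Prop := {
  fc_11 : a1 * a1 + b1 * b1 = E * (1 - l1 * l1);
  fc_22 : a2 * a2 + b2 * b2 = E * (1 - l2 * l2);
  fc_33 : a3 * a3 + b3 * b3 = E * (1 - l3 * l3);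
  fc_13 : a1 * a3 + b1 * b3 = - (E * (l1 * l3));
  fc_23 : a2 * a3 + b2 * b3 = - (E * (l2 * l3));
  fc_l1 : a2 * b3 - a3 * b2 = E * l1;
  fc_l2 : a3 * b1 - a1 * b3 = E * l2;
  fc_unit : l2 * l2 = 1 - l1 * l1 - l3 * l3;
  fc_cr1 : - (a1 * (1 - l3) + l1 * a3) = b2 * (1 - l3) + l2 * b3;
  fc_cr2 : a2 * (1 - l3) + l2 * a3 = b1 * (1 - l3) + l1 * b3 }.

Lemma conformal_frame_coordinates (a b l : R3) (E : R) :
  conformal_frame a b l E ->
  frame_coordinates (c1 a) (c2 a) (c3 a) (c1 b) (c2 b) (c3 b) (c1 l) (c2 l) (c3 l) E.
Proof.
  intros HF.
  destruct (frame_triple_products _ _ _ _ HF) as [Hb Ha].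
  destruct (frame_expansion a b l (1, 0, 0) E HF) as (H11 & _ & _).
  destruct (frame_expansion a b l (0, 1, 0) E HF) as (_ & H22 & _).
  destruct (frame_expansion a b l (0, 0, 1) E HF) as (H13 & H23 & H33).
  destruct HF as (HE & Haa & Hbb & Hab & Hll & Hal & Hbl & Hc).
  destruct a as [[a1 a2] a3], b as [[b1 b2] b3], l as [[l1 l2] l3].
  unfold dot, cross, scal3, c1, c2, c3 in *; simpl in *.
  injection Hb as B1 B2 B3. injection Ha as A1 A2 A3. injection Hc as L1 L2 L3.
  split; lra.
Qed.

(** Stereographic projection from the north pole. *)
Definition stereo (l : R3) : C := (c1 l / (1 - c3 l), c2 l / (1 - c3 l)).

(** The value of [w'] for [w] the stereographic projection of the normal [l]: the quotient
    rule with [l_x = - a / E]. *)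
Definition gauss_deriv (a l : R3) (E : R) : C :=
  (- (c1 a * (1 - c3 l) + c1 l * c3 a) / (E * (1 - c3 l) ^ 2),
   - (c2 a * (1 - c3 l) + c2 l * c3 a) / (E * (1 - c3 l) ^ 2)).

(** A coordinate of [M_x - i M_y], the isotropic vector whose real integral is [M]. *)
Definition isotropic (f : R3 -> R) (a b : R3) : C := (f a, - f b).

(** Replaces the frame by its nine coordinates and the relations between them. As
    [gauss_deriv] is written with [a] only, the lemmas below rewrite with [CR1] and [CR2] to
    bring in [b], so that the symmetric sums [ai * aj + bi * bj] appear. *)
Ltac coordinates :=
  let HF := fresh in let Hd := fresh "Hd" in
  intros HF Hd; pose proof (proj1 HF) as HE;
  apply conformal_frame_coordinates in HF;
  destruct HF as [F11 F22 F33 F13 F23 L1 L2 Hunit CR1 CR2];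
  unfold gauss_deriv, stereo, isotropic, Ci, Cminus, Cplus, Copp, Cmult, RtoC; cbn [fst snd];
  revert Hd F11 F22 F33 F13 F23 L1 L2 Hunit CR1 CR2;
  match goal with a : R3, b : R3, l : R3 |- _ =>
    generalize (c1 a) (c2 a) (c3 a) (c1 b) (c2 b) (c3 b) (c1 l) (c2 l) (c3 l) end;
  intros a1 a2 a3 b1 b2 b3 l1 l2 l3 Hd F11 F22 F33 F13 F23 L1 L2 Hunit CR1 CR2.

(** As [1 - l3 = 2 / (1 + |w|^2)], this is the statement that the Gauss map is conformal and
    scales the metric by [1 / E^2]. In particular [w'] has no zero. *)
Lemma gauss_deriv_norm (a b l : R3) (E : R) :
  conformal_frame a b l E -> 1 - c3 l <> 0 ->
  fst (gauss_deriv a l E) ^ 2 + snd (gauss_deriv a l E) ^ 2 = / (E * (1 - c3 l) ^ 2).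
Proof.
  coordinates.
  rewrite CR2.
  transitivity (((1 - l3) ^ 2 * (a1 * a1 + b1 * b1) + 2 * (1 - l3) * l1 * (a1 * a3 + b1 * b3)
    + l1 * l1 * (a3 * a3 + b3 * b3)) / (E * (1 - l3) ^ 2) ^ 2); [field; lra|].
  rewrite F11, F13, F33. field. lra.
Qed.

(** This and the next two lemmas invert the Weierstrass formulas: with [w] read off from the
    normal and [w'] from the Weingarten equations, the three integrands are the coordinates of
    [M_x - i M_y]. *)
Lemma gauss_weierstrass_1 (a b l : R3) (E : R) :
  conformal_frame a b l E -> 1 - c3 l <> 0 ->
  (stereo l * stereo l - 1 = gauss_deriv a l E * (2 * isotropic c1 a b))%C.
Proof.
  coordinates.
  rewrite CR2.
  f_equal.
  - transitivity (- 2 * ((1 - l3) * (a1 * a1 + b1 * b1) + l1 * (a1 * a3 + b1 * b3)) / (E * (1 - l3) ^ 2));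
      [|field; lra].
    rewrite F11, F13.
    transitivity ((l1 * l1 - l2 * l2 - (1 - l3) ^ 2) / (1 - l3) ^ 2); [field; lra|].
    rewrite Hunit. field; lra.
  - transitivity (2 * l1 * (a3 * b1 - a1 * b3) / (E * (1 - l3) ^ 2));
      [|field; lra].
    rewrite L2. field; lra.
Qed.

Lemma gauss_weierstrass_2 (a b l : R3) (E : R) :
  conformal_frame a b l E -> 1 - c3 l <> 0 ->
  (stereo l * stereo l + 1 = gauss_deriv a l E * (2 * Ci * isotropic c2 a b))%C.
Proof.
  coordinates.
  rewrite CR1.
  f_equal.
  - transitivity (2 * ((1 - l3) * (a2 * a2 + b2 * b2) + l2 * (a2 * a3 + b2 * b3)) / (E * (1 - l3) ^ 2));
      [|field; lra].
    rewrite F22, F23.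
    transitivity ((l1 * l1 - l2 * l2 + (1 - l3) ^ 2) / (1 - l3) ^ 2); [field; lra|].
    transitivity (2 * (1 - l3 - l2 * l2) / (1 - l3) ^ 2); [rewrite Hunit|]; field; lra.
  - transitivity (2 * l2 * (a2 * b3 - a3 * b2) / (E * (1 - l3) ^ 2));
      [|field; lra].
    rewrite L1. field; lra.
Qed.

Lemma gauss_weierstrass_3 (a b l : R3) (E : R) :
  conformal_frame a b l E -> 1 - c3 l <> 0 ->
  (stereo l = - (gauss_deriv a l E * isotropic c3 a b))%C.
Proof.
  coordinates.
  f_equal.
  - rewrite CR2.
    transitivity (((1 - l3) * (a1 * a3 + b1 * b3) + l1 * (a3 * a3 + b3 * b3)) / (E * (1 - l3) ^ 2));
      [|field; lra].
    rewrite F13, F33. field; lra.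
  - rewrite CR1.
    transitivity (((1 - l3) * (a2 * a3 + b2 * b3) + l2 * (a3 * a3 + b3 * b3)) / (E * (1 - l3) ^ 2));
      [|field; lra].
    rewrite F23, F33. field; lra.
Qed.

(** * The Gauss map in the complex coordinate *)

Lemma stereo_coordinate_differentiable (n h : R -> R -> R) (x y nx ny hx hy : R) :
  1 - h x y <> 0 ->
  differentiable_pt_lim n x y nx ny -> differentiable_pt_lim h x y hx hy ->
  differentiable_pt_lim (fun s t => n s t / (1 - h s t)) x y
    ((nx * (1 - h x y) + n x y * hx) / (1 - h x y) ^ 2)
    ((ny * (1 - h x y) + n x y * hy) / (1 - h x y) ^ 2).
Proof.
  intros Hd Hn Hh.
  assert (Hq : differentiable_pt_lim (fun s t => s / (1 - t)) (n x y) (h x y)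
    (/ (1 - h x y)) (n x y / (1 - h x y) ^ 2)).
  { assert (Hdx : forall s t, is_derive (fun z => z / (1 - t)) s (/ (1 - t))).
    { intros s t. unfold Rdiv. auto_derive; [trivial|ring]. }
    assert (Hdy : is_derive (fun z => n x y / (1 - z)) (h x y) (n x y / (1 - h x y) ^ 2)).
    { auto_derive; [exact Hd|field; exact Hd]. }
    rewrite <- (is_derive_unique _ _ _ (Hdx (n x y) (h x y))).
    rewrite <- (is_derive_unique _ _ _ Hdy).
    apply (C1_differentiable (fun s t => s / (1 - t))).
    - exists (mkposreal 1 Rlt_0_1); intros s t _ _. now exists (/ (1 - t)).
    - now exists (n x y / (1 - h x y) ^ 2).
    - apply continuity_2d_pt_ext with (fun s t : R => / (1 - t)).
      + intros s t. symmetry. apply is_derive_unique, Hdx.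
      + apply continuity_2d_pt_inv; [|exact Hd].
        apply continuity_2d_pt_minus; [apply continuity_2d_pt_const|apply continuity_2d_pt_id2]. }
  pose proof (differentiable_pt_lim_comp _ _ _ _ _ _ _ _ _ _ _ Hq Hn Hh) as H.
  match type of H with differentiable_pt_lim _ _ _ ?u ?v =>
    replace ((nx * (1 - h x y) + n x y * hx) / (1 - h x y) ^ 2) with u by (field; exact Hd);
    replace ((ny * (1 - h x y) + n x y * hy) / (1 - h x y) ^ 2) with v by (field; exact Hd) end.
  exact H.
Qed.

Definition gauss_map (l : R -> R -> R3) (z : C) : C := stereo (l (fst z) (snd z)).

(** The Cauchy-Riemann equations: two numbers give all four partial derivatives. They hold
    because [l_x = - a / E] and [l_y = b / E] have opposite signs, that is because the surface
    is minimal: its Gauss map reverses orientation, and so does stereographic projection from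
    the north pole. *)
Lemma gauss_map_differentiable (l : R -> R -> R3) (x y : R) (a b : R3) (E : R) :
  conformal_frame a b (l x y) E -> 1 - c3 (l x y) <> 0 ->
  differentiable3 l x y (scal3 (- / E) a) (scal3 (/ E) b) ->
  let w' := gauss_deriv a (l x y) E in
  differentiable_pt_lim (fun s t => Re (gauss_map l (s, t))) x y (fst w') (- snd w') /\
  differentiable_pt_lim (fun s t => Im (gauss_map l (s, t))) x y (snd w') (fst w').
Proof.
  intros HF Hd (D1 & D2 & D3) w'.
  assert (HE : 0 < E) by apply HF.
  pose proof (stereo_coordinate_differentiable _ _ _ _ _ _ _ _ Hd D1 D3) as Hu.
  pose proof (stereo_coordinate_differentiable _ _ _ _ _ _ _ _ Hd D2 D3) as Hv.
  apply conformal_frame_coordinates in HF.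
  destruct HF as [_ _ _ _ _ _ _ _ CR1 CR2].
  cbv beta in Hu, Hv. unfold scal3 in Hu, Hv.
  cbn [c1 c2 c3 fst snd] in Hu, Hv.
  split.
  - match type of Hu with differentiable_pt_lim _ _ _ ?p ?q =>
      replace (fst w') with p; [replace (- snd w') with q; [exact Hu|]|] end;
    unfold w', gauss_deriv, c1, c2, c3 in *; cbn [fst snd] in *.
    + rewrite CR2. field. lra.
    + field. lra.
  - match type of Hv with differentiable_pt_lim _ _ _ ?p ?q =>
      replace (snd w') with p; [replace (fst w') with q; [exact Hv|]|] end;
    unfold w', gauss_deriv, c1, c2, c3 in *; cbn [fst snd] in *.
    + rewrite CR1. field. lra.
    + field. lra.
Qed.

Lemma gauss_map_derive (l : R -> R -> R3) (x y : R) (a b : R3) (E : R) :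
  conformal_frame a b (l x y) E -> 1 - c3 (l x y) <> 0 ->
  differentiable3 l x y (scal3 (- / E) a) (scal3 (/ E) b) ->
  @is_derive C_AbsRing C_NormedModule (gauss_map l) (x, y) (gauss_deriv a (l x y) E).
Proof.
  intros HF Hd HD.
  destruct (gauss_map_differentiable l x y a b E HF Hd HD) as [Hu Hv].
  rewrite (surjective_pairing (gauss_deriv a (l x y) E)).
  apply (is_derive_ext (K := C_AbsRing) (V := C_NormedModule)
    (fun z : C => (Re (gauss_map l (fst z, snd z)), Im (gauss_map l (fst z, snd z))) : C)).
  - intros z. unfold gauss_map. cbn [fst snd]. symmetry. apply surjective_pairing.
  - now apply (cauchy_riemann_is_derive (fun s t => Re (gauss_map l (s, t)))
      (fun s t => Im (gauss_map l (s, t)))).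
Qed.

(** Since [1 + |w|^2 = 2 / (1 - l3)] and [|w'|^2 = 1 / (E (1 - l3)^2)], the function [mu]
    is a quarter of the normal curvature [1 / E]. *)
Lemma gauss_map_mu (l : R -> R -> R3) (x y : R) (a b : R3) (E : R) :
  conformal_frame a b (l x y) E -> 1 - c3 (l x y) <> 0 ->
  differentiable3 l x y (scal3 (- / E) a) (scal3 (/ E) b) ->
  mu (gauss_map l) x y = / (4 * E).
Proof.
  intros HF Hd HD.
  destruct (gauss_map_differentiable l x y a b E HF Hd HD) as [Hu _].
  apply differentiable_pt_lim_unique in Hu. destruct Hu as [Hux Huy].
  pose proof (gauss_deriv_norm _ _ _ _ HF Hd) as Hn.
  unfold mu. cbv zeta.
  change (dx (fun s t => Re (gauss_map l (s, t))) x y)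
    with (Derive (fun s => Re (gauss_map l (s, y))) x).
  change (dy (fun s t => Re (gauss_map l (s, t))) x y)
    with (Derive (fun t => Re (gauss_map l (x, t))) y).
  rewrite Hux, Huy.
  replace ((- snd (gauss_deriv a (l x y) E)) ^ 2) with (snd (gauss_deriv a (l x y) E) ^ 2) by ring.
  rewrite Hn.
  destruct HF as (HE & _ & _ & _ & Hll & _).
  unfold gauss_map, stereo; cbn [fst snd Re Im].
  unfold dot in Hll.
  revert Hd Hll. generalize (c1 (l x y)) (c2 (l x y)) (c3 (l x y)). intros l1 l2 l3 Hd Hll.
  replace ((l1 / (1 - l3)) ^ 2 + (l2 / (1 - l3)) ^ 2 + 1) with (2 / (1 - l3)).
  - field. lra.
  - transitivity ((l1 * l1 + l2 * l2 + l3 * l3 + 1 - 2 * l3) / (1 - l3) ^ 2); [|field; lra].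
    rewrite Hll. field; lra.
Qed.

(** The constants in [isotropic_path_integral] are [2, 1 / 2], then [2 i, - i / 2], then
    [- 1, - 1]; the second of each pair is the factor in front of the integral. *)
Lemma weierstrass_integrals (A : C -> Prop) (m l a b : R -> R -> R3) (E : R -> R -> R)
  (p q : C) (c : R -> C) :
  open A ->
  (forall x y, A (x, y) ->
     conformal_frame (a x y) (b x y) (l x y) (E x y) /\ 1 - c3 (l x y) <> 0 /\
     differentiable3 l x y (scal3 (- / E x y) (a x y)) (scal3 (/ E x y) (b x y)) /\
     differentiable3 m x y (a x y) (b x y) /\
     continuous3 a x y /\ continuous3 b x y) ->
  path_in A p q c ->
  let w := gauss_map l in
  exists I1 I2 I3 : C,
    is_path_integral (fun z => ((w z * w z - 1) / C_derive w z)%C) c I1 /\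
    is_path_integral (fun z => ((w z * w z + 1) / C_derive w z)%C) c I2 /\
    is_path_integral (fun z => (w z / C_derive w z)%C) c I3 /\
    sub3 (m (fst q) (snd q)) (m (fst p) (snd p)) =
      (Re (1 / 2 * I1)%C, Re (- (Ci / 2) * I2)%C, Re (- I3)%C).
Proof.
  intros HA H Hc w.
  assert (Hw : forall x y, A (x, y) ->
    exists w', C_derive w (x, y) = w' /\ w' <> RtoC 0 /\
     (w (x, y) * w (x, y) - 1 = w' * (2 * isotropic c1 (a x y) (b x y)))%C /\
     (w (x, y) * w (x, y) + 1 = w' * (2 * Ci * isotropic c2 (a x y) (b x y)))%C /\
     (w (x, y) = - (w' * isotropic c3 (a x y) (b x y)))%C).
  { intros x y Hz. destruct (H x y Hz) as (HF & Hd & Hl & _).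
    exists (gauss_deriv (a x y) (l x y) (E x y)). repeat split.
    - now apply is_C_derive_unique, (gauss_map_derive l x y _ (b x y)).
    - intros H0. pose proof (gauss_deriv_norm _ _ _ _ HF Hd) as Hn. rewrite H0 in Hn.
      simpl in Hn. assert (HE : 0 < E x y) by apply HF.
      assert (0 < / (E x y * (1 - c3 (l x y)) ^ 2)); [|simpl in *; lra].
      apply Rinv_0_lt_compat, Rmult_lt_0_compat; [exact HE|]. now apply pow2_gt_0.
    - now apply gauss_weierstrass_1.
    - now apply gauss_weierstrass_2.
    - now apply (gauss_weierstrass_3 _ (b x y)). }
  assert (H20 : RtoC 2 <> RtoC 0) by (intros H0; injection H0; lra).
  destruct (isotropic_path_integral A (fun z => ((w z * w z - 1) / C_derive w z)%C)
    (fun x y => c1 (m x y)) (fun x y => c1 (a x y)) (fun x y => c1 (b x y))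
    2 (1 / 2) p q c HA) as (I1 & HI1 & E1).
  { now field. }
  { intros x y Hz. destruct (Hw x y Hz) as (w' & Hder & Hne & -> & _).
    destruct (H x y Hz) as (_ & _ & _ & Hm & Ha & Hb).
    split; [rewrite Hder; unfold isotropic; now field|].
    now split; [apply Hm|split; [apply Ha|apply Hb]]. }
  { exact Hc. }
  destruct (isotropic_path_integral A (fun z => ((w z * w z + 1) / C_derive w z)%C)
    (fun x y => c2 (m x y)) (fun x y => c2 (a x y)) (fun x y => c2 (b x y))
    (2 * Ci) (- (Ci / 2)) p q c HA) as (I2 & HI2 & E2).
  { transitivity (- (Ci * Ci))%C; [now field|]. unfold Ci, Cmult, Copp, RtoC; simpl. f_equal; ring. }
  { intros x y Hz. destruct (Hw x y Hz) as (w' & Hder & Hne & _ & -> & _).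
    destruct (H x y Hz) as (_ & _ & _ & Hm & Ha & Hb).
    split; [rewrite Hder; unfold isotropic; now field|].
    now split; [apply Hm|split; [apply Ha|apply Hb]]. }
  { exact Hc. }
  destruct (isotropic_path_integral A (fun z => (w z / C_derive w z)%C)
    (fun x y => c3 (m x y)) (fun x y => c3 (a x y)) (fun x y => c3 (b x y))
    (-(1)) (-(1)) p q c HA) as (I3 & HI3 & E3).
  { ring. }
  { intros x y Hz. destruct (Hw x y Hz) as (w' & Hder & Hne & _ & _ & Hw3).
    destruct (H x y Hz) as (_ & _ & _ & Hm & Ha & Hb).
    split; [rewrite Hder, Hw3; unfold isotropic; now field|].
    now split; [apply Hm|split; [apply Ha|apply Hb]]. }
  { exact Hc. }
  exists I1, I2, I3. repeat split; trivial.
  rewrite E1, E2. replace (- I3)%C with (- (1) * I3)%C by ring. now rewrite E3.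
Qed.

(** * Canonical principal parameters *)

(** Minimality and [nu1 > nu2] force [nu1 > 0], hence [E = 1 / nu1 > 0]; the orientation of
    the principal frame gives the cross product. *)
Lemma canonical_conformal_frame (D : C -> Prop) (M l : R -> R -> R3) (x y : R) :
  regular_surface D M l -> principal_parameters D M l -> minimal D M l ->
  canonical_parameters D M l -> D (x, y) ->
  conformal_frame (vdx M x y) (vdy M x y) (l x y) (coefE M x y) /\ coefG M x y = coefE M x y.
Proof.
  intros (_ & _ & Hreg) Hprin Hmin Hcan Hz.
  destruct (Hreg x y Hz) as (_ & Hll & Hal & Hbl).
  destruct (Hprin x y Hz) as (_ & HF & _ & Hor & Hgt).
  specialize (Hmin x y Hz).
  destruct (Hcan x y Hz) as (HE & HG & _).
  assert (HEp : 0 < coefE M x y).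
  { rewrite HE. apply Rdiv_lt_0_compat; lra. }
  assert (HGE : coefG M x y = coefE M x y) by now rewrite HE, HG.
  split; [|exact HGE].
  unfold conformal_frame. repeat split; trivial.
  rewrite Hor. unfold frameX, frameY. rewrite HGE.
  assert (Hs : sqrt (coefE M x y) * sqrt (coefE M x y) = coefE M x y) by (apply sqrt_sqrt; lra).
  assert (Hs0 : 0 < sqrt (coefE M x y)) by now apply sqrt_lt_R0.
  rewrite <- Hs at 1.
  revert Hs0. generalize (sqrt (coefE M x y)) (vdx M x y) (vdy M x y). intros r a b Hr.
  unfold cross, scal3, c1, c2, c3; simpl; f_equal; [f_equal|]; field; lra.
Qed.

(** The Weingarten equations [l_x = - nu M_x], [l_y = nu M_y]. Differentiating
    [M_x . l = M_y . l = 0] gives the tangential parts of [l_x] and [l_y] in terms of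
    [e = 1], [f = 0], [g = - 1], and differentiating [l . l = 1] shows that there is no normal
    part. *)
Lemma canonical_weingarten (D : C -> Prop) (M l : R -> R -> R3) (x y : R) :
  open D -> regular_surface D M l -> principal_parameters D M l -> minimal D M l ->
  canonical_parameters D M l -> D (x, y) ->
  differentiable3 l x y (scal3 (- / coefE M x y) (vdx M x y)) (scal3 (/ coefE M x y) (vdy M x y)).
Proof.
  intros HD Hreg Hprin Hmin Hcan Hz.
  destruct (canonical_conformal_frame D M l x y Hreg Hprin Hmin Hcan Hz) as [HF _].
  destruct Hreg as (HM & Hl & Hreg).
  destruct (Hcan x y Hz) as (_ & _ & _ & He & Hf & Hg).
  pose proof (smooth3_differentiable3 D l x y HD Hl Hz) as Dl.
  pose proof (smooth3_differentiable3 D _ x y HD (smooth3_vdx D M HM) Hz) as Da.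
  pose proof (smooth3_differentiable3 D _ x y HD (smooth3_vdy D M HM) Hz) as Db.
  assert (Hloc : forall (h : R -> R -> R) k, (forall s t, D (s, t) -> h s t = k) ->
    locally_2d (fun s t => h s t = k) x y).
  { intros h k Hh. generalize (open_locally_2d D x y HD Hz).
    apply locally_2d_impl, locally_2d_forall. exact Hh. }
  destruct (differentiable_locally_constant _ x y _ _ 0
    (Hloc _ _ (fun s t Hst => proj1 (proj2 (proj2 (Hreg s t Hst)))))
    (differentiable_dot _ _ _ _ _ _ _ _ Da Dl)) as [Hax Hay].
  destruct (differentiable_locally_constant _ x y _ _ 0
    (Hloc _ _ (fun s t Hst => proj2 (proj2 (proj2 (Hreg s t Hst)))))
    (differentiable_dot _ _ _ _ _ _ _ _ Db Dl)) as [Hbx Hby].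
  destruct (differentiable_locally_constant _ x y _ _ 1
    (Hloc _ _ (fun s t Hst => proj1 (proj2 (Hreg s t Hst))))
    (differentiable_dot _ _ _ _ _ _ _ _ Dl Dl)) as [Hlx Hly].
  assert (Hsch : vdx (vdy M) x y = vdy (vdx M) x y).
  { destruct HM as (M1 & M2 & M3).
    assert (S1 := smooth_schwarz D _ x y HD M1 Hz).
    assert (S2 := smooth_schwarz D _ x y HD M2 Hz).
    assert (S3 := smooth_schwarz D _ x y HD M3 Hz).
    unfold vdx, vdy. f_equal; [f_equal|]; assumption. }
  (* [M_y . l_x = - M_yx . l], whereas [f] is defined by [M_xy . l] *)
  rewrite Hsch in Hbx.
  change (dot (vdx (vdx M) x y) (l x y)) with (coefe M l x y) in Hax.
  change (dot (vdy (vdx M) x y) (l x y)) with (coeff M l x y) in Hay, Hbx.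
  change (dot (vdy (vdy M) x y) (l x y)) with (coefg M l x y) in Hby.
  rewrite (dot_comm (l x y)) in Hlx, Hly.
  rewrite He in Hax. rewrite Hf in Hay, Hbx. rewrite Hg in Hby.
  pose proof (frame_det _ _ _ _ HF) as Hdet.
  destruct HF as (HE & Haa & Hbb & Hab & _ & Hal & Hbl & _).
  assert (Hdot : forall p k u v, dot (sub3 p (scal3 k u)) v = dot p v - k * dot u v).
  { intros. unfold dot, sub3, scal3, c1, c2, c3; simpl; ring. }
  replace (scal3 (- / coefE M x y) (vdx M x y)) with (vdx l x y).
  replace (scal3 (/ coefE M x y) (vdy M x y)) with (vdy l x y).
  exact Dl.
  - apply sub3_eq0, (orthogonal_to_frame _ (vdx M x y) (vdy M x y) (l x y)); [lra| | |]; rewrite Hdot.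
    + rewrite (dot_comm (vdy M x y)), Hab, dot_comm. lra.
    + rewrite Hbb, dot_comm. field_simplify; lra.
    + rewrite Hbl. lra.
  - apply sub3_eq0, (orthogonal_to_frame _ (vdx M x y) (vdy M x y) (l x y)); [lra| | |]; rewrite Hdot.
    + rewrite Haa, dot_comm. field_simplify; lra.
    + rewrite Hab, dot_comm. lra.
    + rewrite Hal. lra.
Qed.

(** * Moving the normal away from the north pole *)

(** For [s = 1] the identity, for [s = - 1] the half-turn about the first axis, which moves
    the north pole to the south pole. *)
Definition turn (s : R) (p : R3) : R3 := (c1 p, s * c2 p, s * c3 p).

Lemma turn_motion (s : R) (o : R3) : s * s = 1 ->
  motion (fun p => sub3 (turn s p) (turn s o)).
Proof.
  intros Hs. split.
  - intros p q. unfold dist3. f_equal.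
    unfold dot, sub3, turn, c1, c2, c3; simpl.
    generalize (fst (fst p)) (snd (fst p)) (snd p) (fst (fst q)) (snd (fst q)) (snd q)
      (fst (fst o)) (snd (fst o)) (snd o); intros.
    match goal with |- _ = ?u * ?u + ?v * ?v + ?w * ?w =>
      transitivity (u * u + (s * s) * (v * v) + (s * s) * (w * w)); [ring|rewrite Hs; ring] end.
  - intros o' p q r.
    match goal with |- 0 < ?d -> 0 < ?d' => replace d' with ((s * s) * d); [now rewrite Hs, Rmult_1_l|] end.
    unfold det3, dot, cross, sub3, turn, c1, c2, c3; simpl. ring.
Qed.

Lemma turn_conformal_frame (s : R) (a b l : R3) (E : R) : s * s = 1 ->
  conformal_frame a b l E -> conformal_frame (turn s a) (turn s b) (turn s l) E.
Proof.
  intros Hs.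
  assert (Hdot : forall u v, dot (turn s u) (turn s v) = dot u v).
  { intros u v.
    transitivity (c1 u * c1 v + (s * s) * (c2 u * c2 v + c3 u * c3 v)).
    - unfold dot, turn, c1, c2, c3; simpl; ring.
    - rewrite Hs; unfold dot; ring. }
  unfold conformal_frame. rewrite !Hdot.
  intros (HE & Haa & Hbb & Hab & Hll & Hal & Hbl & Hc).
  repeat split; trivial.
  transitivity (turn s (scal3 E l)).
  - rewrite <- Hc.
    transitivity ((s * s) * c1 (cross a b), s * c2 (cross a b), s * c3 (cross a b)).
    + unfold cross, turn, c1, c2, c3; simpl; f_equal; [f_equal|]; ring.
    + rewrite Hs, Rmult_1_l. reflexivity.
  - unfold turn, scal3, c1, c2, c3; simpl; f_equal; [f_equal|]; ring.
Qed.

Lemma turn_differentiable3 (s : R) (m : R -> R -> R3) (x y : R) (a b : R3) :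
  differentiable3 m x y a b ->
  differentiable3 (fun u v => turn s (m u v)) x y (turn s a) (turn s b).
Proof.
  intros (H1 & H2 & H3). split; [exact H1|]. now split; apply differentiable_scal.
Qed.

Lemma turn_continuous3 (s : R) (m : R -> R -> R3) (x y : R) :
  continuous3 m x y -> continuous3 (fun u v => turn s (m u v)) x y.
Proof.
  intros (H1 & H2 & H3). split; [exact H1|].
  now split; (apply continuity_2d_pt_mult; [apply continuity_2d_pt_const|]).
Qed.

(** * The representation theorem *)

(** Differentiability of [g] is needed as well as [Derive g t <> 0]: the total operator
    [Derive] may be nonzero at a point where no derivative exists. *)
Lemma Derive_inv_quadruple (h g : R -> R) (t : R) :
  locally t (fun s => h s = / (4 * g s)) -> ex_derive g t -> 0 < g t -> Derive g t <> 0 ->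
  Derive h t <> 0.
Proof.
  intros Hh Hex Hg Hne.
  assert (H : is_derive (fun s => / (4 * g s)) t (- Derive g t / (4 * g t ^ 2))).
  { apply Derive_correct in Hex. auto_derive; [split; [now exists (Derive g t)|lra]|].
    change (Derive (fun x : R => g x) t) with (Derive g t). field. lra. }
  pose proof (eq_trans (Derive_ext_loc _ _ _ Hh) (is_derive_unique _ _ _ H)) as HD.
  intros H0. rewrite H0 in HD. apply Hne.
  replace (Derive g t) with (- (4 * g t ^ 2) * (- Derive g t / (4 * g t ^ 2))) by (field; lra).
  rewrite <- HD; ring.
Qed.

Theorem theorem1 (D : C -> Prop) (M l : R -> R -> R3)
  (hDopen : open D) (hDconn : connected_set D)
  (hreg : regular_surface D M l)
  (hprin : principal_parameters D M l)
  (hmin : minimal D M l)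
  (hstrong : strongly_regular D M)
  (hcan : canonical_parameters D M l)
  (z0 : C) (hz0 : D z0) :
  exists (D0 : C -> Prop) (w : C -> C),
    (forall z, D0 z -> D z) /\ open D0 /\ D0 z0 /\ simply_connected D0 /\
    holomorphic_on D0 w /\
    (forall x y, D0 (x, y) ->
       0 < mu w x y /\ dx (mu w) x y * dy (mu w) x y <> 0) /\
    exists T : R3 -> R3, motion T /\
      forall x y, D0 (x, y) ->
      forall c : R -> C, path_in D0 z0 (x, y) c ->
      exists I1 I2 I3 : C,
        is_path_integral
          (fun z => ((w z * w z - 1) / C_derive w z)%C) c I1 /\
        is_path_integral
          (fun z => ((w z * w z + 1) / C_derive w z)%C) c I2 /\
        is_path_integral (fun z => (w z / C_derive w z)%C) c I3 /\
        T (M x y) =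
          (Re (1 / 2 * I1)%C, Re (- (Ci / 2) * I2)%C, Re (- I3)%C).
Proof.
  pose proof hreg as (HM & Hl & _).
  destruct z0 as [x0 y0].
  assert (Hs : exists s, s * s = 1 /\ 1 - c3 (turn s (l x0 y0)) <> 0).
  { (* the half-turn is applied only if the normal at the base point is the north pole *)
    destruct (Req_dec (c3 (l x0 y0)) 1) as [H1 | H1].
    - exists (-1). split; [lra|]. unfold turn, c3 in *; simpl. rewrite H1. lra.
    - exists 1. split; [lra|]. unfold turn, c3 in *; simpl. lra. }
  destruct Hs as (s & Hs & Hpole).
  set (l' := fun u v => turn s (l u v)).
  assert (Hnear : locally ((x0, y0) : C) (fun z => D z /\ 1 - c3 (l' (fst z) (snd z)) <> 0)).
  { apply filter_and; [now apply hDopen|].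
    apply (locally_2d_locally (fun u v => 1 - c3 (l' u v) <> 0)).
    apply continuity_2d_pt_neq_0; [|exact Hpole].
    apply continuity_2d_pt_minus; [apply continuity_2d_pt_const|].
    apply (turn_continuous3 s l x0 y0). now apply (smooth3_continuous3 D). }
  destruct Hnear as [r Hr].
  set (D0 := fun z : C => @ball C_UniformSpace (x0, y0) r z).
  assert (HD0 : open D0) by apply open_ball_C.
  set (E := coefE M).
  assert (HD0D : forall z, D0 z -> D z) by (intros z Hz; now apply Hr).
  assert (Hdata : forall x y, D0 (x, y) ->
     conformal_frame (turn s (vdx M x y)) (turn s (vdy M x y)) (l' x y) (E x y) /\
     1 - c3 (l' x y) <> 0 /\
     differentiable3 l' x y (scal3 (- / E x y) (turn s (vdx M x y)))
       (scal3 (/ E x y) (turn s (vdy M x y))) /\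
     differentiable3 (fun u v => turn s (M u v)) x y (turn s (vdx M x y)) (turn s (vdy M x y)) /\
     continuous3 (fun u v => turn s (vdx M u v)) x y /\
     continuous3 (fun u v => turn s (vdy M u v)) x y).
  { intros x y Hz. pose proof (HD0D _ Hz) as HDz.
    repeat match goal with |- _ /\ _ => split end.
    - apply turn_conformal_frame; [exact Hs|]. now apply (canonical_conformal_frame D).
    - now apply (Hr (x, y)).
    - assert (Hts : forall k p, scal3 k (turn s p) = turn s (scal3 k p)).
      { intros k p. unfold scal3, turn, c1, c2, c3; simpl; f_equal; [f_equal|]; ring. }
      rewrite !Hts. apply turn_differentiable3. now apply (canonical_weingarten D).
    - apply turn_differentiable3. now apply (smooth3_differentiable3 D).
    - apply turn_continuous3. apply (smooth3_continuous3 D); [now apply smooth3_vdx|exact HDz].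
    - apply turn_continuous3. apply (smooth3_continuous3 D); [now apply smooth3_vdy|exact HDz]. }
  set (w := gauss_map l').
  assert (Hmu : forall x y, D0 (x, y) -> mu w x y = / (4 * E x y)).
  { intros x y Hz. destruct (Hdata x y Hz) as (HF & Hd & Hdl & _).
    now apply (gauss_map_mu l' x y _ _ _ HF Hd). }
  assert (HG : forall x y, D (x, y) -> coefG M x y = E x y /\ 0 < E x y).
  { intros x y Hz.
    destruct (canonical_conformal_frame D M l x y hreg hprin hmin hcan Hz) as [HF HG].
    split; [exact HG|apply HF]. }
  exists D0, w. repeat match goal with |- _ /\ _ => split end.
  - exact HD0D.
  - exact HD0.
  - apply ball_center.
  - apply convex_simply_connected. intros t p q. apply ball_segment.
  - intros [x y] Hz. destruct (Hdata x y Hz) as (HF & Hd & Hdl & _).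
    exists (gauss_deriv (turn s (vdx M x y)) (l' x y) (E x y)).
    now apply (gauss_map_derive l' x y _ _ _ HF Hd).
  - intros x y Hz. pose proof (HD0D _ Hz) as HDz.
    destruct (HG x y HDz) as [HGE HE].
    pose proof (open_locally_2d D0 x y HD0 Hz) as Hloc.
    split.
    + rewrite Hmu by exact Hz. apply Rinv_0_lt_compat. lra.
    + specialize (hstrong x y HDz). unfold gamma1, gamma2 in hstrong.
      pose proof (smooth3_differentiable3 D _ x y hDopen (smooth3_vdx D M HM) HDz) as Da.
      pose proof (smooth3_differentiable3 D _ x y hDopen (smooth3_vdy D M HM) HDz) as Db.
      assert (HEy : dy E x y <> 0).
      { intros H0. apply hstrong. change (coefE M) with E. rewrite H0. unfold Rdiv. ring. }
      assert (HGx : dx (coefG M) x y <> 0).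
      { intros H0. apply hstrong. rewrite H0. unfold Rdiv. ring. }
      (* [gamma2] contains the derivative of [G] and [gamma1] that of [E], so [mu] is taken
         as [1 / (4 G)] along the lines [y = const] and as [1 / (4 E)] along [x = const] *)
      apply Rmult_integral_contrapositive_currified.
      * apply (Derive_inv_quadruple _ (fun t => coefG M t y)).
        -- apply (locally_2d_1d_const_y (fun u v => mu w u v = / (4 * coefG M u v))).
           generalize Hloc. apply locally_2d_impl, locally_2d_forall. intros u v Huv.
           rewrite (proj1 (HG u v (HD0D _ Huv))). now apply Hmu.
        -- apply (differentiable_ex_derive _ x y _ _ (differentiable_dot _ _ _ _ _ _ _ _ Db Db)).
        -- now rewrite HGE.
        -- exact HGx.
      * apply (Derive_inv_quadruple _ (fun t => E x t)).
        -- apply (locally_2d_1d_const_x (fun u v => mu w u v = / (4 * E u v))).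
           generalize Hloc. apply locally_2d_impl, locally_2d_forall. exact Hmu.
        -- apply (differentiable_ex_derive _ x y _ _ (differentiable_dot _ _ _ _ _ _ _ _ Da Da)).
        -- exact HE.
        -- exact HEy.
  - exists (fun p => sub3 (turn s p) (turn s (M x0 y0))). split; [now apply turn_motion|].
    intros x y Hz c Hc.
    exact (weierstrass_integrals D0 (fun u v => turn s (M u v)) l'
      (fun u v => turn s (vdx M u v)) (fun u v => turn s (vdy M u v)) E _ _ c HD0 Hdata Hc).
Qed.
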